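(* Let $(E,\iota,\pi)$ be a twist over a locally compact, Hausdorff and r-discrete groupoid $G$ with non-compact unit space $G^{(0)}$, and let $\widetilde G$ be the Alexandrov groupoid of $G$, with unit space $\widetilde G^{(0)}=G^{(0)}\cup\{\infty\}$. Set $\widetilde E=E\cup\{\infty_z: z\in\mathbf T\}$ and $\widetilde E^{(2)}=E^{(2)}\cup\{(\infty_w,\infty_z): z,w\in\mathbf T\}$, with composition of pairs in $E^{(2)}$ as in $E$ and $\infty_w\infty_z=\infty_{wz}$ for all $w,z\in\mathbf T$. Define $\widetilde r,\widetilde s:\widetilde E\to G^{(0)}\cup\{\infty\}$ by $\widetilde r|_E=r$, $\widetilde s|_E=s$ and $\widetilde r(\infty_w)=\infty=\widetilde s(\infty_w)$ for all $w\in\mathbf T$, and define $\widetilde\iota:\widetilde G^{(0)}\times\mathbf T\to\widetilde E$ by $\widetilde\iota|_{G^{(0)}\times\mathbf T}=\iota$ and $\widetilde\iota(\infty,z)=\infty_z$. Then: (1) The collection $\mathfrak V$ consisting of $\widetilde E$, the open sets of $E$ and the sets $\widetilde\iota(V)$, where $V$ is an open subset of $\widetilde G^{(0)}\times\mathbf T$, is a basis for a topology on $\widetilde E$ with respect to which $\widetilde\iota$ is open and continuous. (2) With respect to this topology, the topology of $E$ coincides with the subspace topology, and $\widetilde E$ is a locally compact and Hausdorff groupoid. (3) Define $\widetilde\pi:\widetilde E\to\widetilde G$ by $\widetilde\pi|_E=\pi$ and $\widetilde\pi(\infty_z)=\infty$. Then $(\widetilde E,\widetilde\iota,\widetilde\pi)$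 is a twist over $\widetilde G$.
   Context: For a topological groupoid $G$ with unit space $G^{(0)}$ and composable pairs $G^{(2)}$, $r(g)=gg^{-1}$, $s(g)=g^{-1}g$; $G$ is r-discrete if $G^{(0)}$ is open in $G$. $\mathbf T$ is the circle group. Twists. A twist $(E,\iota,\pi)$ over a locally compact Hausdorff groupoid $G$ consists of a locally compact Hausdorff groupoid $E$ and groupoid homomorphisms $G^{(0)}\times\mathbf T\xrightarrow{\iota}E\xrightarrow{\pi}G$ (with $G^{(0)}\times\mathbf T$ the trivial group bundle) such that: (i) $\iota$ is a homeomorphism onto $\pi^{-1}(G^{(0)})$ (subspace topology) with $\iota(\pi(u),1)=u$ for all $u\in E^{(0)}$; (ii) $\pi$ is a continuous open surjection; (iii) $\iota(\pi(r(e)),z)e=e\,\iota(\pi(s(e)),z)$ for all $e\in E$, $z\in\mathbf T$. One identifies $E^{(0)}$ with $G^{(0)}$ via $\pi$; likewise the unit $\infty_1$ of $\widetilde E$ is identified with $\infty$. Inversion on $\widetilde E$ extends that of $E$ by $\infty_z^{-1}=\infty_{\overline z}$. Alexandrov groupoid. Let $G^{(0)}_+=G^{(0)}\cup\{\infty\}$ be the one-point compactification of $G^{(0)}$. Put $\widetilde G=G\cup\{\infty\}$, $\widetilde G^{(2)}=G^{(2)}\cup\{(\infty,\infty)\}$, $\widetilde G^{(0)}=G^{(0)}_+$; multiplication and inversion extend those of $G$ with $\infty\infty=\infty=\infty^{-1}$, and $r,s$ extend so that $r^{-1}(\infty)=s^{-1}(\infty)=\{\infty\}$. The topology of $\widetilde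 G$ has as basis the collection consisting of $\widetilde G$, all open subsets of $G^{(0)}_+$ and all open subsets of $G$; with it $\widetilde G$ is a locally compact Hausdorff r-discrete groupoid. *)

(* Defs.v *)
From HB Require Import structures.
From mathcomp Require Import all_boot all_order all_algebra finmap.
From mathcomp Require Export complex.
From mathcomp Require Export all_classical all_reals.
From mathcomp Require Export topology.

Set Implicit Arguments.
Unset Strict Implicit.
Unset Printing Implicit Defensive.

Import Order.TTheory GRing.Theory Num.Theory.

Local Open Scope classical_set_scope.
Local Open Scope ring_scope.

(** * Groupoids *)

(* [gmul] is total, but its values outside of [gcomp] are never used. *)
Record groupoid_ops (T : Type) := GroupoidOps {
  gcomp : set (T * T);
  gmul : T -> T -> T;
  ginv : T -> T }.

Section groupoid.
Context {T : Type} (o : groupoid_ops T).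

Definition grange (x : T) : T := gmul o x (ginv o x).
Definition gsource (x : T) : T := gmul o (ginv o x) x.
Definition gunits : set T := range grange.

(* The standard axiomatisation by a set of composable pairs; it implies
   [gcomp o (x, y) <-> gsource x = grange y] *)
Definition is_groupoid : Prop :=
  [/\ involutive (ginv o),
      forall x y z, gcomp o (x, y) -> gcomp o (y, z) ->
        [/\ gcomp o (gmul o x y, z), gcomp o (x, gmul o y z) &
            gmul o (gmul o x y) z = gmul o x (gmul o y z)],
      forall x, gcomp o (ginv o x, x),
      forall x y, gcomp o (x, y) -> gmul o (ginv o x) (gmul o x y) = y &
      forall x y, gcomp o (x, y) -> gmul o (gmul o x y) (ginv o y) = x].

End groupoid.

Definition groupoid_hom (S T : Type) (oS : groupoid_ops S)
    (oT : groupoid_ops T) (f : S -> T) : Prop :=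
  forall x y, gcomp oS (x, y) ->
    gcomp oT (f x, f y) /\ f (gmul oS x y) = gmul oT (f x) (f y).

Definition is_topological_groupoid (T : topologicalType)
    (o : groupoid_ops T) : Prop :=
  [/\ is_groupoid o,
      {within gcomp o, continuous (fun p : T * T => gmul o p.1 p.2)} &
      continuous (ginv o)].

Definition is_lch_groupoid (T : topologicalType) (o : groupoid_ops T) : Prop :=
  [/\ is_topological_groupoid o, locally_compact [set: T] & hausdorff_space T].

Definition r_discrete (T : topologicalType) (o : groupoid_ops T) : Prop :=
  open (gunits o).

(** * The circle group *)

(* [R[i]^o] carries the topology of the modulus. *)
Definition unit_circle (R : realType) : set R[i]^o := [set z | `|z| = 1].

Arguments unit_circle R : clear implicits.

Notation circle R := (set_type (unit_circle R)).

Section circle.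
Context {R : realType}.

Lemma circle1_subproof : (1 : R[i]) \in unit_circle R.
Proof. by rewrite inE /unit_circle /= normr1. Qed.

Lemma circleM_subproof (w z : circle R) :
  (val w * val z : R[i]) \in unit_circle R.
Proof.
by rewrite inE /unit_circle /= normrM (set_mem (valP w)) (set_mem (valP z)) mul1r.
Qed.

Lemma circleV_subproof (z : circle R) :
  (conjc (val z : R[i])) \in unit_circle R.
Proof. by rewrite inE /unit_circle /= normcJ; exact: (set_mem (valP z)). Qed.

Definition circle1 : circle R := Sub 1 circle1_subproof.
Definition circleM (w z : circle R) : circle R :=
  Sub (val w * val z) (circleM_subproof w z).
Definition circleV (z : circle R) : circle R :=
  Sub (conjc (val z)) (circleV_subproof z).

Definition trivial_bundle_ops (X : Type) : groupoid_ops (X * circle R) :=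
  GroupoidOps [set p | p.1.1 = p.2.1]
    (fun p q => (p.1, circleM p.2 q.2)) (fun p => (p.1, circleV p.2)).

End circle.

(** * Twists *)

Definition homeomorphism_onto (X Y : topologicalType) (f : X -> Y)
    (A : set Y) : Prop :=
  [/\ injective f, range f = A, continuous f &
      forall V : set X, open V ->
        exists2 W : set Y, open W & f @` V = A `&` W].

Definition open_map (X Y : topologicalType) (f : X -> Y) : Prop :=
  forall U : set X, open U -> open (f @` U).

Section twist.
Context {R : realType} {G E : topologicalType}.
Context (oG : groupoid_ops G) (oE : groupoid_ops E).
Context (iota : gunits oG * circle R -> E) (pi : E -> G).

(* As [iota] takes its first argument in the subtype of units, an element
   [pi e] of the unit space enters it as the [u] such that [val u = pi e]. *)
Definition is_twist : Prop :=
  [/\ is_lch_groupoid oG /\ is_lch_groupoid oE,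
      groupoid_hom (trivial_bundle_ops (gunits oG)) oE iota /\
        groupoid_hom oE oG pi,
      homeomorphism_onto iota (pi @^-1` gunits oG) /\
        (forall e (u : gunits oG), gunits oE e -> val u = pi e ->
          iota (u, circle1) = e),
      [/\ continuous pi, open_map pi & range pi = [set: G]] &
      forall e z (u v : gunits oG),
        val u = pi (grange oE e) -> val v = pi (gsource oE e) ->
        gmul oE (iota (u, z)) e = gmul oE e (iota (v, z))].

End twist.

Arguments is_twist {R G E} oG oE iota pi.

(** * Alexandrov groupoid *)

Definition alexandrov (G : topologicalType) (oG : groupoid_ops G) : Type :=
  option G.

Section alexandrov.
Context {G : topologicalType} (oG : groupoid_ops G).

Local Notation alexandrov := (alexandrov oG).

Definition alexandrov_ops : groupoid_ops alexandrov :=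
  GroupoidOps
    [set p : alexandrov * alexandrov | match p with
     | (Some x, Some y) => gcomp oG (x, y)
     | (None, None) => True
     | _ => False
     end]
    (fun x y => match x, y with
     | Some x, Some y => Some (gmul oG x y)
     | _, _ => None
     end)
    (omap (ginv oG)).

Definition alexandrov_unit
    (x : one_point_compactification (gunits oG)) : alexandrov :=
  omap val x.

Lemma alexandrov_unitsE : gunits alexandrov_ops = range alexandrov_unit.
Proof.
apply/seteqP; split=> [_ [[g|] _ <-]|_ [[u|] _ <-]]; last by exists None.
- by exists (Some (Sub (grange oG g) (mem_set (imageT _ g)))).
- by exists None.
- by have /set_mem[g _ gu] := valP u; exists (Some g) => //=; rewrite -gu.
Qed.

Definition alexandrov_basis : set (set alexandrov) :=
  [set setT]
  `|` [set alexandrov_unit @` U |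
        U in @open (one_point_compactification (gunits oG))]
  `|` [set Some @` U | U in @open G].

(* The topology generated by [alexandrov_basis], of which it is a basis when
   the unit space is open, see [alexandrov_basisP] *)
HB.instance Definition _ := Choice.on alexandrov.
HB.instance Definition _ :=
  isSubBaseTopological.Build alexandrov alexandrov_basis id.

End alexandrov.

Arguments alexandrov_basis {G} oG _.

Section alexandrov_basis_theory.
Context {G : topologicalType} (oG : groupoid_ops G).

Local Notation alexandrov := (alexandrov oG).

Lemma alexandrov_basisI (A B : set alexandrov) : r_discrete oG ->
  alexandrov_basis oG A -> alexandrov_basis oG B ->
  alexandrov_basis oG (A `&` B).
Proof.
move=> rdG; have mixed (U : set (one_point_compactification (gunits oG)))
    (V : set G) : open U -> open V ->
    alexandrov_basis oG ((@alexandrov_unit _ oG @` U) `&` (Some @` V)).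
  move=> oU oV; have oSU : open (Some @^-1` U : set (gunits oG)).
    by apply: open_comp oU => x _; exact: one_point_compactification_some_continuous.
  have [W oW WU] := oSU; right; exists (V `&` (W `&` gunits oG)).
    by apply: openI => //; exact: openI.
  apply/seteqP; split=> [_ [g [Vg [Wg ug]] <-]|_ [[[u|] Uu <-] [g Vg]] //].
    split; last by exists g.
    exists (Some (Sub g (mem_set ug) : gunits oG)) => //.
    by have : (Some @^-1` U) (Sub g (mem_set ug) : gunits oG) by rewrite -WU.
  move=> [gu]; exists g; last by rewrite gu.
  split => //; split.
    by rewrite gu; have : (Some @^-1` U) u by []; rewrite -WU.
  by rewrite gu; exact: set_mem (valP u).
case=> [[->|[U oU <-]]|[U oU <-]]; first by rewrite setTI.
- case=> [[->|[V oV <-]]|[V oV <-]]; [|left; right|exact: mixed].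
  + by rewrite setIT; left; right; exists U.
  + exists (U `&` V); first exact: openI.
    apply/seteqP; split=> [_ [u [Uu Vu] <-]|_ [[u Uu <-] [v Vv]]].
      by split; exists u.
    case: u v Uu Vv => [u|] [v|] //= Uu Vv; last by exists None.
    by move=> [] /val_inj uv; exists (Some u) => //; split => //; rewrite -uv.
- case=> [[->|[V oV <-]]|[V oV <-]].
  + by rewrite setIT; right; exists U.
  + by rewrite setIC; exact: mixed.
  + right; exists (U `&` V); first exact: openI.
    apply/seteqP; split=> [_ [u [Uu Vu] <-]|_ [[u Uu <-] [v Vv]]].
      by split; exists u.
    by case=> vu; exists u => //; split => //; rewrite -vu.
Qed.

Lemma alexandrov_basisP : r_discrete oG -> basis (alexandrov_basis oG).
Proof.
move=> rdG; split=> [A BA|x A /=].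
  exists [set A]; last by rewrite bigcup_set1.
  move=> _ ->; exists [fset A]%fset.
    by move=> B /fset1P ->; exact: mem_set.
  by rewrite set_fset1 bigcap_set1.
rewrite nbhsE => -[_ [[D' D'f <-]] [F D'F /= Fx] FA].
suff [B [BB Bx] BF] : filter_from [set U | alexandrov_basis oG U /\ U x] id F.
  by exists B => // y By; apply: FA; exists F => //; exact: BF.
have [fs fsB FE] := D'f _ D'F.
have {}fsB A' : A' \in fs -> alexandrov_basis oG A'.
  by move=> /fsB /set_mem.
move: Fx; rewrite -FE => {FE D'F FA}.
exists (\bigcap_(i in [set` fs]) i) => //; split => //.
rewrite -bigsetI_fset_set // set_fsetK.
rewrite big_seq; elim/big_ind: _ => //.
- by left; left.
- by move=> *; exact: alexandrov_basisI.
Qed.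

End alexandrov_basis_theory.

(** * Extension of a twist to the Alexandrov groupoid *)

Definition twist_ext (R : realType) (G E : topologicalType)
    (oG : groupoid_ops G) (iota : gunits oG * circle R -> E) : Type :=
  (E + circle R)%type.

Section extension.
Context {R : realType} {G E : topologicalType}.
Context (oG : groupoid_ops G) (oE : groupoid_ops E).
Context (iota : gunits oG * circle R -> E) (pi : E -> G).

Local Notation twist_ext := (twist_ext iota).

Definition twist_ext_ops : groupoid_ops twist_ext :=
  GroupoidOps
    [set p : twist_ext * twist_ext | match p with
     | (inl e, inl f) => gcomp oE (e, f)
     | (inr _, inr _) => True
     | _ => False
     end]
    (fun x y => match x, y with
     | inl e, inl f => inl (gmul oE e f)
     | inr w, inr z => inr (circleM w z)
     | _, _ => x
     end)
    (fun x => match x with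
     | inl e => inl (ginv oE e)
     | inr z => inr (circleV z)
     end).

(* [insub] turns a unit [g] of [G] into an element of the subtype. *)
Definition iota_ext
    (p : gunits (alexandrov_ops oG) * circle R) : twist_ext :=
  if obind insub (val p.1) is Some u then inl (iota (u, p.2)) else inr p.2.

Definition pi_ext (x : twist_ext) : alexandrov oG :=
  if x is inl e then Some (pi e) else None.

(* The unit space of [E] is identified with that of [G] by [pi]. *)
Definition range_ext (x : twist_ext) : alexandrov oG :=
  if x is inl e then Some (pi (grange oE e)) else None.
Definition source_ext (x : twist_ext) : alexandrov oG :=
  if x is inl e then Some (pi (gsource oE e)) else None.

Lemma iota_ext_some (x : gunits (alexandrov_ops oG)) (u : gunits oG) z :
  val x = Some (val u) -> iota_ext (x, z) = inl (iota (u, z)).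
Proof. by rewrite /iota_ext /= => ->; rewrite /= valK. Qed.

Lemma iota_ext_infty (x : gunits (alexandrov_ops oG)) z :
  val x = None -> iota_ext (x, z) = inr z.
Proof. by rewrite /iota_ext /= => ->. Qed.

Definition twist_ext_basis : set (set twist_ext) :=
  [set setT]
  `|` [set inl @` U | U in @open E]
  `|` [set iota_ext @` V |
        V in @open (gunits (alexandrov_ops oG) * circle R)%type].

(* A family of sets is a basis for some topology if and only if it is a basis
   for the topology that it generates. *)
HB.instance Definition _ := Choice.on twist_ext.
HB.instance Definition _ :=
  isSubBaseTopological.Build twist_ext twist_ext_basis id.

End extension.

Arguments twist_ext_ops {R G E oG} oE iota.
Arguments iota_ext {R G E oG} iota p.
Arguments pi_ext {R G E oG} iota pi x.
Arguments range_ext {R G E oG} oE iota pi x.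
Arguments source_ext {R G E oG} oE iota pi x.
Arguments twist_ext_basis {R G E oG} iota _.

(* Main.v *)
(* The extended twist carries two open embeddings: that of [E], and [iota_ext],
   whose domain is the product of the one-point compactification of the unit
   space with the circle and is therefore compact. Their ranges cover
   [twist_ext], and they overlap in the clopen part of [E] above the units, so
   local compactness, separation and continuity of the operations can all be
   checked in one of the two charts. Multiplication near infinity takes place in
   the second one, where it is that of a trivial bundle: as [pi] inverts [iota]
   on the first component, [iota_ext] reflects composability. The Alexandrov
   groupoid is handled likewise, with the charts [Some] and [alexandrov_unit]. *)

Require Import Defs.
From mathcomp Require Import all_boot all_order all_algebra.
From mathcomp Require Import ring lra.
From mathcomp Require Import all_classical all_reals topology normedtype.

Set Implicit Arguments.
Unset Strict Implicit.
Unset Printing Implicit Defensive.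

Import Order.TTheory GRing.Theory Num.Theory.
Import numFieldNormedType.Exports.

Local Open Scope classical_set_scope.
Local Open Scope ring_scope.

(** * General topology *)

Lemma finI_from_setI_closed (T : choiceType) (B : set (set T)) :
  B [set: T] -> setI_closed B -> finI_from B id `<=` B.
Proof.
move=> BT BI _ [F FB <-]; rewrite -bigsetI_fset_set // set_fsetK big_seq.
by elim/big_ind: _ => // C /FB /set_mem.
Qed.

Lemma image_setI_inj (X Y : Type) (f : X -> Y) (A C : set X) :
  injective f -> f @` (A `&` C) = f @` A `&` f @` C.
Proof.
move=> injf; apply/seteqP; split=> [|_ [[x Ax <-] [y Cy /injf yx]]].
  exact: sub_image_setI.
by exists x; split=> //; rewrite -yx.
Qed.

Lemma open_map_nbhs (X T : topologicalType) (f : X -> T) x (U : set X) :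
  open_map f -> nbhs x U -> nbhs (f x) (f @` U).
Proof.
rewrite nbhsE => of_ [V [oV Vx] VU].
apply: (@filterS _ _ _ (f @` V)); first exact: image_subset.
by apply: open_nbhs_nbhs; split; [exact: of_|exists x].
Qed.

(** * Bases of a topology and tests on basic open sets *)

Section basis.
Context {T : topologicalType} (B : set (set T)).

(** The hypothesis on [open] spells out the topology generated by [B]; by stability, the finite
    intersections are members of [B] themselves. *)
Lemma basis_of_subbase :
  @open T = [set \bigcup_(A in D) A | D in subset^~ (finI_from B id)] ->
  B [set: T] -> setI_closed B -> basis B.
Proof.
move=> oE BT BI; split=> [A BA|x A /=].
  rewrite oE; exists [set A]; last by rewrite bigcup_set1.
  by move=> _ ->; exact: finI_from1.
rewrite nbhsE => -[W []]; rewrite oE => -[D DB <-] [C DC Cx] WA.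
exists C; first by split=> //; apply: finI_from_setI_closed (DB _ DC).
by move=> y Cy; apply: WA; exists C.
Qed.

Hypothesis basisB : basis B.

Lemma basis_open_sub (W : set T) x : open W -> W x ->
  exists A, [/\ B A, A x & A `<=` W].
Proof.
move=> oW Wx; have [_ /(_ x W)[|A [BA Ax] AW]] := basisB.
  exact: open_nbhs_nbhs.
by exists A.
Qed.

Lemma basis_continuous (S : topologicalType) (f : S -> T) :
  (forall A, B A -> open (f @^-1` A)) -> continuous f.
Proof.
move=> oB x W; rewrite nbhsE => -[V [oV Vfx] VW].
have [A [BA Afx AV]] := basis_open_sub oV Vfx.
apply: (@filterS _ _ _ (f @^-1` A)) => [y Ay|]; first exact/VW/AV.
by apply: open_nbhs_nbhs; split => //; exact: oB.
Qed.

Lemma basis_open_map (S : topologicalType) (f : T -> S) :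
  (forall A, B A -> open (f @` A)) -> open_map f.
Proof.
move=> oB W oW; rewrite openE => _ [x Wx <-].
have [A [BA Ax AW]] := basis_open_sub oW Wx.
apply: (@filterS _ _ _ (f @` A)); first exact: image_subset.
by apply: open_nbhs_nbhs; split; [exact: oB|exists x].
Qed.

End basis.

(** * Spaces covered by two open charts *)

Section two_charts.
Context {T X Y : topologicalType} (f : X -> T) (g : Y -> T).
Hypothesis fg_cover : forall t, range f t \/ range g t.
Hypotheses (f_open : open_map f) (g_open : open_map g).

(** Two points of one chart are separated there. A point outside [range g] and a point of [range g]
    are separated by the image under [f] of the complement of the overlap, open because the overlap
    is closed in [X], and by [range g] itself. *)
Lemma chart_hausdorff : injective f -> injective g ->
  hausdorff_space X -> hausdorff_space Y ->
  closed (f @^-1` range g) -> hausdorff_space T.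
Proof.
move=> injf injg hX hY clg.
have sep x y : ~ range g (f x) -> cluster (nbhs (f x)) (g y) -> False.
  move=> gfx clxy.
  have [||_ [[x' gx' <-] [y' _ gy']]] :=
      clxy (f @` ~` (f @^-1` range g)) (range g).
  - apply: open_map_nbhs => //; apply: open_nbhs_nbhs; split=> //.
    by rewrite openC.
  - by apply: open_map_nbhs => //; exact: filterT.
  - by apply: gx'; exists y'.
have cluster_sym (p q : T) : cluster (nbhs p) q -> cluster (nbhs q) p.
  by move=> clpq A C qA pC; rewrite setIC; exact: clpq.
(* Open injective maps carry disjoint neighbourhoods to disjoint neighbourhoods. *)
have injE (Z : topologicalType) (h : Z -> T) (x y : Z) :
    injective h -> open_map h -> hausdorff_space Z ->
    cluster (nbhs (h x)) (h y) -> x = y.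
  move=> injh oh hZ clxy; apply: hZ => U V xU yV.
  have [||_ [[u Uu <-] [v Vv vu]]] := clxy (h @` U) (h @` V).
  - exact: open_map_nbhs.
  - exact: open_map_nbhs.
  - by exists u; split=> //; rewrite -(injh _ _ vu).
move=> p q; case: (fg_cover p) => [[x _ <-]|[y _ <-]].
  case: (pselect (range g (f x))) => [[y _ <-]|gx].
    case: (fg_cover q) => [[x' _ <-]|[y' _ <-]]; last first.
      by move=> clyy; rewrite (injE Y g y y').
    case: (pselect (range g (f x'))) => [[y' _ <-]|gx'].
      by move=> clyy; rewrite (injE Y g y y').
    by move=> /cluster_sym /(sep _ _ gx').
  case: (fg_cover q) => [[x' _ <-]|[y' _ <-] /(sep _ _ gx) //].
  by move=> clxx; rewrite (injE X f x x').
case: (pselect (range g q)) => [[y' _ <-]|].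
  by move=> clyy; rewrite (injE Y g y y').
case: (fg_cover q) => [[x' _ <-] gx'|//].
by move=> /cluster_sym /(sep _ _ gx').
Qed.

(** A compact neighbourhood in a chart has a compact neighbourhood as image; separation of [T] makes
    it closed, which [compact_near] also demands. *)
Lemma chart_locally_compact : continuous f -> continuous g ->
  hausdorff_space T -> locally_compact [set: X] -> locally_compact [set: Y] ->
  locally_compact [set: T].
Proof.
move=> cf cg hT lX lY.
have chart (Z : topologicalType) (h : Z -> T) z : continuous h -> open_map h ->
    locally_compact [set: Z] -> compact_near (within [set: T] (nbhs (h z))).
  move=> ch oh lZ; have [U] := lZ z I; rewrite !withinET => zU [cU clU].
  have cpt : compact (h @` U).
    by apply: continuous_compact => //; exact: continuous_subspaceT.
  exists (h @` U); last by split => //; exact: compact_closed.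
  exact: open_map_nbhs.
by move=> t _; case: (fg_cover t) => -[z _ <-]; exact: chart.
Qed.

End two_charts.

(** * Compactness and separation in products and subspaces *)

Lemma compact_locally_compact (X : topologicalType) :
  compact [set: X] -> locally_compact [set: X].
Proof.
move=> cX x _; exists [set: X]; last by split => //; exact: closedT.
exact: filterT.
Qed.

Lemma hausdorff_injective (X Y : topologicalType) (f : X -> Y) :
  continuous f -> injective f -> hausdorff_space Y -> hausdorff_space X.
Proof.
move=> cf injf hY x y clxy; apply/injf/hY => A C xA yC.
have [z [zA zC]] := clxy _ _ (cf x A xA) (cf y C yC).
by exists (f z).
Qed.

Lemma hausdorff_prod (X Y : topologicalType) :
  hausdorff_space X -> hausdorff_space Y -> hausdorff_space (X * Y)%type.
Proof.
move=> hX hY [x y] [x' y'] cl; congr (_, _).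
- apply: hX => A C xA xC.
  have [||[u v] [Au Cu]] := cl (fst @^-1` A) (fst @^-1` C); last by exists u.
  + exact: cvg_fst.
  + exact: cvg_fst.
- apply: hY => A C xA xC.
  have [||[u v] [Au Cu]] := cl (snd @^-1` A) (snd @^-1` C); last by exists v.
  + exact: cvg_snd.
  + exact: cvg_snd.
Qed.

Lemma val_continuous (X : topologicalType) (A : set X) :
  continuous (val : A -> X).
Proof. exact: initial_continuous. Qed.

Lemma val_open_map (X : topologicalType) (A : set X) :
  open A -> open_map (val : A -> X).
Proof.
move=> oA _ [V oV <-]; rewrite (_ : _ @` _ = V `&` A); first exact: openI.
apply/seteqP; split=> [_ [u Vu <-]|x [Vx Ax]].
  by split=> //; exact: set_mem (valP u).
by exists (Sub x (mem_set Ax)).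
Qed.

Lemma compact_setX_setT (X Y : topologicalType) :
  compact [set: X] -> compact [set: Y] -> compact [set: X * Y].
Proof. by move=> cX cY; rewrite -setXTT; exact: compact_setX. Qed.

Lemma closed_subtype_locally_compact (X : topologicalType) (A : set X) :
  closed A -> locally_compact [set: X] -> locally_compact [set: A].
Proof.
move=> clA lX x _; have [K] := lX (val x) I; rewrite !withinET => xK [cK clK].
exists (val @^-1` K); first exact: val_continuous.
split; last first.
  by apply: preimage_closed clK => y _; exact: val_continuous.
(* Pushed forward to [X], the filter clusters at a point of [K]; this point lies in [A] because [A]
   is closed, and is then a cluster point in the subtype. *)
move=> F FF FK; have [p [Kp clp]] := cK (val @ F) _ FK.
have Ap : A p.
  apply: clA => V pV; have [|y [Ay Vy]] := clp A V _ pV; last by exists y.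
  by apply: (@filterE _ F) => y; exact: set_mem (valP y).
exists (Sub p (mem_set Ap)); split=> // C V FC [_ [[W oW <-] /= Wp] WV].
have [|y [[u Cu uy] Wy]] := clp (val @` C) W _ (open_nbhs_nbhs (conj oW Wp)).
  by apply: (@filterS _ F _ C) => // u Cu; exists u.
by exists u; split=> //; apply: WV; rewrite /= /set_val /= uy.
Qed.

(** * The circle group *)

Section circle.
Context {R : realType}.
Implicit Types w z : circle R.

Lemma circleC w z : circleM w z = circleM z w.
Proof. by apply: val_inj; rewrite /= mulrC. Qed.

Lemma circleA w z t : circleM (circleM w z) t = circleM w (circleM z t).
Proof. by apply: val_inj; rewrite /= mulrA. Qed.

Lemma circle1M z : circleM circle1 z = z.
Proof. by apply: val_inj; rewrite /= mul1r. Qed.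

Lemma circleMV z : circleM z (circleV z) = circle1.
Proof.
apply: val_inj => /=; have := set_mem (valP z); rewrite /unit_circle /= => z1.
by have := sqr_normc (val z); rewrite z1 expr1n.
Qed.

Lemma circleVK : involutive (@circleV R).
Proof. by move=> z; apply: val_inj; rewrite /= conjcK. Qed.

Lemma circleVM w z : circleM (circleV w) (circleM w z) = z.
Proof. by rewrite -circleA (circleC (circleV w)) circleMV circle1M. Qed.

Lemma circleMK w z : circleM (circleM w z) (circleV z) = w.
Proof. by rewrite circleA circleMV circleC circle1M. Qed.

Lemma circleM_continuous :
  continuous (fun p : circle R * circle R => circleM p.1 p.2).
Proof.
apply: continuous_comp_initial => p /=.
apply: (@continuous2_cvg _ _ _ _ _ _ _ _ (fun x y : R[i]^o => x * y : R[i]^o)).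
- exact: (@mul_continuous R[i] (val p.1, val p.2)).
- apply: (@cvg_comp _ _ _ _ (val : circle R -> _)); first exact: cvg_fst.
  exact: val_continuous.
- apply: (@cvg_comp _ _ _ _ (val : circle R -> _)); first exact: cvg_snd.
  exact: val_continuous.
Qed.

Lemma conjc_continuous : continuous (@conjc R : R[i]^o -> R[i]^o).
Proof.
move=> z A [e /= e0 eA]; exists e => //= x zx; apply: eA => /=.
by rewrite -rmorphB normcJ.
Qed.

Lemma circleV_continuous : continuous (@circleV R).
Proof.
apply: continuous_comp_initial => z /=.
apply: (@continuous_comp _ _ _ (val : circle R -> _)
  (@conjc R : R[i]^o -> R[i]^o)); first exact: val_continuous.
exact: conjc_continuous.
Qed.

Lemma circle_hausdorff : hausdorff_space (circle R).
Proof.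
apply: (hausdorff_injective (val_continuous (A := _))) val_inj _.
exact: (@norm_hausdorff R[i] R[i]^o).
Qed.

(** * Compactness of the circle *)

Lemma circleN1_subproof : (-1 : R[i]) \in unit_circle R.
Proof. by rewrite inE /unit_circle /= normrN1. Qed.

(** Numerator and denominator are conjugate, hence of equal modulus. *)
Lemma cayley_subproof (t : R) :
  ((1 +i* t)%C / (1 -i* t)%C : R[i]) \in unit_circle R.
Proof.
rewrite inE /unit_circle /= normrM normfV -(normcJ (1 +i* t)%C) divff //.
by rewrite normr_eq0 eq_complex /= oner_eq0.
Qed.

(* The Cayley transform gives the compactness of the circle without resorting
   to angles: it is continuous, and two half circles cover the circle. *)
Definition cayley (t : R) : circle R :=
  Sub ((1 +i* t)%C / (1 -i* t)%C) (cayley_subproof t).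

Lemma cayley_onto z : 0 <= complex.Re (val z) ->
  exists2 t, t \in `[-1, 1] & cayley t = z.
Proof.
have /= := set_mem (valP z); rewrite /unit_circle /=.
case vz : (val z) => [a b] /= z1 a0.
have ab1 : a ^+ 2 + b ^+ 2 = 1.
  by have := sqr_normc (a +i* b)%C; rewrite z1 expr1n => -[ab1 _]; lra.
(* The tangent of half the argument of [z]; it lies in the segment since [b^2 <= 1 <= (1 + a)^2]. *)
exists (b / (1 + a)).
  have a10 : 0 < 1 + a by lra.
  by rewrite in_itv /= ler_pdivlMr // ler_pdivrMr //; apply/andP; split; nra.
apply: val_inj => /=; rewrite vz.
have a10 : 1 + a != 0 by apply: lt0r_neq0; lra.
apply: (canLR (mulfK _)); first by rewrite eq_complex /= oner_eq0.
apply/eqP; rewrite eq_complex /=; apply/andP; split; apply/eqP.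
  have b2 : b * b = (1 - a) * (1 + a) by rewrite -!expr2; lra.
  rewrite mulrN opprK mulrA b2; field => //.
by field.
Qed.

Lemma cayley_continuous : continuous cayley.
Proof.
apply: continuous_comp_initial => t /=.
have num : continuous (fun s : R => (1 +i* s)%C : R[i]^o).
  move=> s A [[r i] /= r0 rA].
  (* Positive elements of [R[i]] are real, so the radius comes down to [R]. *)
  have [i0 {}r0] : i = 0 /\ 0 < r by move: r0; rewrite ltcE /= => /andP[/eqP ->].
  exists r => //= u su; apply: rA; rewrite /= normc_def /= subrr expr0n add0r.
  by rewrite sqrtr_sqr i0 ltcR.
have den : continuous (fun s : R => (1 -i* s)%C : R[i]^o).
  move=> s; apply: (@continuous_comp R R[i]^o R[i]^o (fun s => (1 +i* s)%C)
    (@conjc R : R[i]^o -> R[i]^o)); first exact: num.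
  exact: conjc_continuous.
apply: (@continuous2_cvg _ _ _ _ _ _ _ _ (fun x y : R[i]^o => x / y : R[i]^o)).
- apply: (@cvgM R[i] _ _ _ (fst : R[i]^o * R[i]^o -> R[i]^o)
    (fun p : R[i]^o * R[i]^o => p.2^-1 : R[i]^o)); first exact: cvg_fst.
  apply: (@cvgV R[i] _ _ _ (snd : R[i]^o * R[i]^o -> R[i]^o)); last exact: cvg_snd.
  by rewrite eq_complex /= oner_eq0.
- exact: num.
- exact: den.
Qed.

Lemma circle_compact : compact [set: circle R].
Proof.
have half (w : circle R) : compact ((fun t => circleM w (cayley t)) @` `[-1, 1]).
  apply: continuous_compact; last exact: segment_compact.
  apply: continuous_subspaceT => t.
  apply: (@continuous_comp _ _ _ (fun t => (w, cayley t))
    (fun p => circleM p.1 p.2)); last exact: circleM_continuous.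
  apply: (@cvg_pair _ _ _ _ (nbhs w) (nbhs (cayley t))); first exact: cvg_cst.
  exact: cayley_continuous.
pose N1 : circle R := Sub (-1) circleN1_subproof.
(* The half circle of nonnegative real part, and its rotation by [N1]. *)
rewrite (_ : setT = (fun t => circleM circle1 (cayley t)) @` `[-1, 1] `|`
                    (fun t => circleM N1 (cayley t)) @` `[-1, 1]).
  by apply: compactU; exact: half.
apply/seteqP; split=> // z _; case: (lerP 0 (complex.Re (val z))) => z0.
  by have [t t1 tz] := cayley_onto z0; left; exists t => //; rewrite circle1M.
right; have [|t t1 tz] := @cayley_onto (circleM N1 z).
  by move: z0 => /=; case: (val z) => a b /=; lra.
exists t => //; rewrite tz; apply: val_inj => /=.
by rewrite mulrA mulrNN !mul1r.
Qed.

End circle.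

(** * Groupoids *)

Section groupoid_algebra.
Context {T : Type} (o : groupoid_ops T).
Hypothesis gpd : is_groupoid o.

Lemma ginvK : involutive (ginv o). Proof. by case: gpd. Qed.

Lemma gmulA x y z : gcomp o (x, y) -> gcomp o (y, z) ->
  [/\ gcomp o (gmul o x y, z), gcomp o (x, gmul o y z) &
      gmul o (gmul o x y) z = gmul o x (gmul o y z)].
Proof. by case: gpd => _ + _ _ _; exact. Qed.

Lemma gcompVx x : gcomp o (ginv o x, x). Proof. by case: gpd. Qed.

Lemma gcompxV x : gcomp o (x, ginv o x).
Proof. by rewrite -{1}(ginvK x); exact: gcompVx. Qed.

Lemma gmulKV x y : gcomp o (x, y) -> gmul o (ginv o x) (gmul o x y) = y.
Proof. by case: gpd => _ _ _ + _; exact. Qed.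

Lemma gmulVK x y : gcomp o (x, y) -> gmul o (gmul o x y) (ginv o y) = x.
Proof. by case: gpd => _ _ _ _ +; exact. Qed.

(** Idempotence is a form of being a unit that homomorphisms preserve. For [u = x x^-1],
    cancellation gives [u x = x], whence [u u = u]; conversely, cancelling in [(u u) u^-1] exhibits
    [u] as [u u^-1]. *)
Lemma gunits_idempotent u :
  gunits o u <-> gcomp o (u, u) /\ gmul o u u = u.
Proof.
split=> [[x _ <-]|[cuu uu]]; last first.
  by exists u => //; rewrite /grange -{1}uu gmulVK.
have [c1 _ _] := gmulA (gcompxV x) (gcompVx x).
have ux : gmul o (grange o x) x = x.
  by rewrite -{3}(gmulVK (gcompxV x)) ginvK.
have [_ c2 e2] := gmulA c1 (gcompxV x).
by split; rewrite // -[RHS]/(gmul o x _) -{3}ux.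
Qed.

Section unit.
Variables (u : T) (uu : gunits o u).

Lemma gcomp_unit : gcomp o (u, u). Proof. by case/gunits_idempotent: uu. Qed.

Lemma gmul_unit : gmul o u u = u. Proof. by case/gunits_idempotent: uu. Qed.

(** From [(x u) u = x (u u) = x u] the last factor [u] cancels. *)
Lemma gmulxu x : gcomp o (x, u) -> gmul o x u = x.
Proof.
move=> cxu; have [_ _] := gmulA cxu gcomp_unit; rewrite gmul_unit.
move=> /(congr1 (fun y => gmul o y (ginv o u))).
have [c _ _] := gmulA cxu gcomp_unit.
by rewrite gmulVK // gmulVK.
Qed.

Lemma gmulux x : gcomp o (u, x) -> gmul o u x = x.
Proof.
move=> cux; have [_ c] := gmulA gcomp_unit cux; rewrite gmul_unit => e.
by have := congr1 (gmul o (ginv o u)) e; rewrite !gmulKV.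
Qed.

Lemma ginv_unit : ginv o u = u.
Proof.
by rewrite -(gmulxu (gcompVx u)) -{2}gmul_unit gmulKV //; exact: gcomp_unit.
Qed.

Lemma grange_unit : grange o u = u.
Proof. by rewrite /grange ginv_unit gmul_unit. Qed.

End unit.

(** The units as fixed points of a map: this is the form from which their closedness follows. *)
Lemma gunitsE : gunits o = [set x | grange o x = x].
Proof.
by apply/seteqP; split=> x; [exact: grange_unit|move=> <-; exists x].
Qed.

(** The product of two composable units equals each of them. *)
Lemma gcomp_units u v : gunits o u -> gunits o v -> gcomp o (u, v) -> u = v.
Proof. by move=> uu uv cuv; rewrite -(gmulxu uv cuv) gmulux. Qed.

Lemma gunits_range x : gunits o (grange o x). Proof. by exists x. Qed.

End groupoid_algebra.

Section groupoid_hom.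
Context {S T : Type} (oS : groupoid_ops S) (oT : groupoid_ops T) (f : S -> T).
Hypotheses (gS : is_groupoid oS) (gT : is_groupoid oT).
Hypothesis homf : groupoid_hom oS oT f.

Lemma hom_units u : gunits oS u -> gunits oT (f u).
Proof.
move=> uu; apply/gunits_idempotent => //.
by have [cff <-] := homf (gcomp_unit gS uu); rewrite gmul_unit.
Qed.

(** The product of [f x] and [f (x^-1)] is the image of a unit, hence a unit; multiplying by the
    inverse of [f x] on the left concludes. *)
Lemma hom_inv x : f (ginv oS x) = ginv oT (f x).
Proof.
have [c e] := homf (gcompxV gS x); have [_ c' _] := gmulA gT (gcompVx gT _) c.
rewrite -(gmulKV gT c) gmulxu // -e.
by apply: hom_units; exact: gunits_range.
Qed.

End groupoid_hom.

Lemma trivial_bundle_groupoid (R : realType) (X : Type) :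
  is_groupoid (trivial_bundle_ops X : groupoid_ops (X * circle R)).
Proof.
split=> /=.
- by move=> [x z] /=; rewrite circleVK.
- by move=> [x w] [y z] [v t] /= -> ->; rewrite circleA.
- by [].
- by move=> [x w] [y z] /= ->; rewrite circleVM.
- by move=> [x w] [y z] /= ->; rewrite circleMK.
Qed.

(** * Topological groupoids *)

(** The topological half of a topological groupoid, set apart from the algebraic laws so that it can
    be transported along charts alone. *)
Definition groupoid_continuous (T : topologicalType) (o : groupoid_ops T) :=
  {within gcomp o, continuous (fun p : T * T => gmul o p.1 p.2)} /\
  continuous (ginv o).

(** The pairs [(x, x^-1)] stay among the composable ones, where multiplication is continuous. *)
Lemma grange_continuous (T : topologicalType) (o : groupoid_ops T) :
  is_topological_groupoid o -> continuous (grange o).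
Proof.
move=> [gpd cmul cinv] x W Wx.
have /subspace_continuousP/(_ (x, ginv o x) (gcompxV gpd x) W Wx) := cmul.
move=> [[U V] [/= xU xV] UVW]; rewrite nbhs_simpl /=.
have {}xV := cinv x V xV.
apply: (filterS _ (filterI xU xV)) => y [Uy Vy].
exact: (UVW (y, ginv o y)) (gcompxV gpd y).
Qed.

(** A unit [y] close to a point [x] of the closure equals its range, which is close to the range of
    [x]; separation forces [x] to be its own range. *)
Lemma closed_gunits (T : topologicalType) (o : groupoid_ops T) :
  is_topological_groupoid o -> hausdorff_space T -> closed (gunits o).
Proof.
move=> tgpd hT; have [gpd _ _] := tgpd; rewrite gunitsE // => x clx.
apply/esym/hT => A C xA rC.
have xC : nbhs x (grange o @^-1` C) by exact: grange_continuous.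
have [y [/= yy [Ay]]] := clx _ (filterI xA xC).
by rewrite /= yy; exists y.
Qed.

(** Reflection of composability is the clause that lets continuity of the product pass from [oX] to
    the image. Inverses have a clause of their own, since neither structure is assumed to be a
    groupoid. *)
Definition groupoid_chart (X T : topologicalType) (oX : groupoid_ops X)
    (oT : groupoid_ops T) (f : X -> T) :=
  [/\ continuous f, open_map f,
      forall a b, gcomp oT (f a, f b) -> gcomp oX (a, b),
      groupoid_hom oX oT f &
      forall a, f (ginv oX a) = ginv oT (f a)].

(** Continuity is local and is checked in a chart; the last hypothesis provides one chart containing
    both factors of a composable pair. *)
Lemma chart_groupoid_continuous (X Y T : topologicalType)
    (oX : groupoid_ops X) (oY : groupoid_ops Y) (oT : groupoid_ops T)
    (f : X -> T) (g : Y -> T) :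
  groupoid_chart oX oT f -> groupoid_chart oY oT g ->
  groupoid_continuous oX -> groupoid_continuous oY ->
  (forall t, range f t \/ range g t) ->
  (forall s t, gcomp oT (s, t) ->
    (range f s /\ range f t) \/ (range g s /\ range g t)) ->
  groupoid_continuous oT.
Proof.
have mulcvg (Z : topologicalType) (oZ : groupoid_ops Z) (h : Z -> T) a b :
    groupoid_chart oZ oT h -> groupoid_continuous oZ -> gcomp oT (h a, h b) ->
    (fun p : T * T => gmul oT p.1 p.2) @ within (gcomp oT) (nbhs (h a, h b))
      --> gmul oT (h a) (h b).
  move=> [ch oh rh homh _] [/subspace_continuousP cmul _] /rh cab W.
  have [_ <-] := homh _ _ cab => /ch /(cmul (a, b) cab).
  (* A composable pair of points from the images of [U] and [V] comes from a composable pair in [U]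
     and [V]. *)
  move=> [[U V] [/= aU bV] UVW]; exists (h @` U, h @` V).
    by split; exact: (open_map_nbhs oh).
  move=> [_ _] [/= [x Ux <-] [y Vy <-]] /rh cxy /=.
  by have [_ <-] := homh _ _ cxy; exact: (UVW (x, y)).
have invcvg (Z : topologicalType) (oZ : groupoid_ops Z) (h : Z -> T) a :
    groupoid_chart oZ oT h -> groupoid_continuous oZ ->
    ginv oT @ (h a) --> ginv oT (h a).
  move=> [ch oh _ _ invh] [_ cinv] W; rewrite -invh => /ch /cinv aW.
  apply: (@filterS _ (nbhs (h a)) _ (h @` (ginv oZ @^-1` (h @^-1` W)))).
    by move=> _ [x /= + <-]; rewrite invh; apply.
  exact: open_map_nbhs.
move=> chf chg cX cY cover cover2; split; last first.
  move=> t; case: (cover t) => -[z _ <-]; first exact: invcvg cX.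
  exact: invcvg cY.
apply/subspace_continuousP => -[s t] cst.
case: (cover2 s t cst) => -[[a _ aE] [b _ bE]]; move: cst; rewrite -aE -bE.
- by move=> cst; exact: mulcvg cX cst.
- by move=> cst; exact: mulcvg cY cst.
Qed.

Lemma trivial_bundle_continuous (R : realType) (X : topologicalType) :
  groupoid_continuous (trivial_bundle_ops X : groupoid_ops (X * circle R)).
Proof.
split.
  apply: continuous_subspaceT => -[[x w] [y z]].
  apply: (@cvg_pair _ _ _ _ (nbhs x) (nbhs (circleM w z))).
    by apply: cvg_comp; [exact: cvg_fst|exact: cvg_fst].
  apply: (@cvg_comp _ _ _
    (fun p : (X * circle R) * (X * circle R) => (p.1.2, p.2.2))
    (fun p => circleM p.1 p.2) _ (nbhs (w, z)));
    last exact: circleM_continuous (w, z).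
  apply: (@cvg_pair _ _ _ _ (nbhs w) (nbhs z)).
    by apply: cvg_comp; [exact: cvg_fst|exact: cvg_snd].
  by apply: cvg_comp; [exact: cvg_snd|exact: cvg_snd].
move=> [x z]; apply: (@cvg_pair _ _ _ _ (nbhs x) (nbhs (circleV z))).
  exact: cvg_fst.
by apply: cvg_comp; [exact: cvg_snd|exact: circleV_continuous].
Qed.

(** * The Alexandrov groupoid *)

Section alexandrov.
Context {G : topologicalType} (oG : groupoid_ops G).
Hypotheses (lchG : is_lch_groupoid oG) (rdG : r_discrete oG).

Local Notation alexandrov := (alexandrov oG).
Local Notation opc := (one_point_compactification (gunits oG)).
Local Notation units := (gunits (alexandrov_ops oG)).
Local Notation unit := (@alexandrov_unit _ oG).

Let gpdG : is_groupoid oG. Proof. by case: lchG => -[]. Qed.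

(** * The two charts [Some] and [alexandrov_unit] *)

Lemma alexandrov_unit_inj : injective unit.
Proof. by move=> [u|] [v|] //= [] /val_inj ->. Qed.

Lemma Some_open_map : open_map (Some : G -> alexandrov).
Proof.
move=> U oU; have [BO _] := alexandrov_basisP rdG.
by apply: BO; right; exists U.
Qed.

Lemma alexandrov_unit_open_map : open_map unit.
Proof.
move=> U oU; have [BO _] := alexandrov_basisP rdG.
by apply: BO; left; right; exists U.
Qed.

Lemma Some_continuous : continuous (Some : G -> alexandrov).
Proof.
apply: (basis_continuous (alexandrov_basisP rdG)).
move=> A [[->|[U oU <-]]|[U oU <-]].
- by rewrite preimage_setT; exact: openT.
(* The finite part is open in the unit space, hence in [G] by r-discreteness. *)
- rewrite (_ : _ @^-1` _ = val @` ((Some : _ -> opc) @^-1` U)).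
    apply: val_open_map => //; apply: open_comp oU => u _.
    exact: one_point_compactification_some_continuous.
  apply/seteqP; split=> [g [[u|] // Uu [<-]]|_ [u Uu <-]]; first by exists u.
  by exists (Some u).
- rewrite (_ : _ @^-1` _ = U) //.
  by apply/seteqP; split=> [g [x Ux [<-]]|g Ug] //; exists g.
Qed.

Lemma alexandrov_unit_continuous : continuous unit.
Proof.
apply: (basis_continuous (alexandrov_basisP rdG)).
move=> A [[->|[U oU <-]]|[U oU <-]].
- by rewrite preimage_setT; exact: openT.
- rewrite (_ : _ @^-1` _ = U) //.
  apply/seteqP; split=> [u [v Uv /alexandrov_unit_inj <-]|u Uu] //.
  by exists u.
(* An open set of [G] meets the units in an open set avoiding infinity, which remains open in the
   compactification. *)
- rewrite (_ : _ @^-1` _ =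
      (Some : _ -> opc) @` ((val : gunits oG -> G) @^-1` U)).
    apply: one_point_compactification_open_some.
    by apply: open_comp oU => u _; exact: val_continuous.
  apply/seteqP; split=> [[u|] [g Ug] // [gu]|_ [u Uu <-]].
    by exists u; rewrite //= -gu.
  by exists (val u).
Qed.

Lemma alexandrov_cover (x : alexandrov) : range Some x \/ range unit x.
Proof. by case: x => [g|]; [left; exists g|right; exists None]. Qed.

(** The overlap of the charts is the unit space, closed in [G]. Being closed, it is also locally
    compact, so that its compactification is Hausdorff. *)
Lemma alexandrov_hausdorff : hausdorff_space alexandrov.
Proof.
have [tG lG hG] := lchG.
apply: (chart_hausdorff alexandrov_cover) => //.
- exact: Some_open_map.
- exact: alexandrov_unit_open_map.
- exact: alexandrov_unit_inj.
- apply: one_point_compactification_hausdorff.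
    by apply: closed_subtype_locally_compact => //; exact: closed_gunits.
  exact: hausdorff_injective (val_continuous (A := _)) val_inj hG.
- rewrite (_ : _ @^-1` _ = gunits oG); first exact: closed_gunits.
  apply/seteqP; split=> [g [[u|] // _ [<-]]|g ug]; first exact: set_mem (valP u).
  by exists (Some (Sub g (mem_set ug))).
Qed.

Lemma alexandrov_locally_compact : locally_compact [set: alexandrov].
Proof.
have [_ lG _] := lchG.
apply: (chart_locally_compact alexandrov_cover) => //.
- exact: Some_open_map.
- exact: alexandrov_unit_open_map.
- exact: Some_continuous.
- exact: alexandrov_unit_continuous.
- exact: alexandrov_hausdorff.
- exact/compact_locally_compact/one_point_compactification_compact.
Qed.

Lemma alexandrov_groupoid : is_groupoid (alexandrov_ops oG).
Proof.
split.
- by move=> [x|] //=; rewrite (ginvK gpdG).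
- move=> [x|] [y|] [z|] //= cxy cyz.
  by have [c1 c2 ->] := gmulA gpdG cxy cyz.
- by move=> [x|] //=; exact: gcompVx.
- by move=> [x|] [y|] //= cxy; rewrite gmulKV.
- by move=> [x|] [y|] //= cxy; rewrite gmulVK.
Qed.

Lemma alexandrov_lch : is_lch_groupoid (alexandrov_ops oG).
Proof.
split; [|exact: alexandrov_locally_compact|exact: alexandrov_hausdorff].
have [[_ cmul cinv] _ _] := lchG.
(* The groupoid consisting of units only: each point is composable just with itself. It is the model
   for the second chart. *)
pose oP : groupoid_ops opc := GroupoidOps [set p | p.1 = p.2] (fun x _ => x) id.
have [//||||||] :=
  @chart_groupoid_continuous _ _ _ oG oP (alexandrov_ops oG) Some unit.
- split=> //; [exact: Some_continuous|exact: Some_open_map].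
- split.
  + exact: alexandrov_unit_continuous.
  + exact: alexandrov_unit_open_map.
  (* Composable units coincide, so the chart reflects composability. *)
  + move=> [u|] [v|] //= cuv; congr Some; apply/val_inj/(gcomp_units gpdG) => //.
      exact: set_mem (valP u).
    exact: set_mem (valP v).
  + move=> x _ /= <-; case: x => [u|] //=; have uu := set_mem (valP u).
    by split; [exact: gcomp_unit|rewrite gmul_unit].
  + by move=> [u|] //=; rewrite ginv_unit //; exact: set_mem (valP u).
- by split.
- have cfst : continuous (fst : opc * opc -> opc) by move=> p; exact: cvg_fst.
  by split; [exact: continuous_subspaceT cfst|move=> p W].
- exact: alexandrov_cover.
- move=> [x|] [y|] //= _; first by left; split; [exists x|exists y].
  by right; split; exists None.
- by move=> c1 c2; split=> //; exact: alexandrov_groupoid.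
Qed.

(** * The unit space of the Alexandrov groupoid *)

Lemma open_alexandrov_units : open units.
Proof.
rewrite alexandrov_unitsE; apply: alexandrov_unit_open_map; exact: openT.
Qed.

Lemma alexandrov_units_hausdorff : hausdorff_space units.
Proof.
exact: hausdorff_injective (val_continuous (A := _)) val_inj alexandrov_hausdorff.
Qed.

Lemma gunits_alexandrov_unit (u : opc) : units (unit u).
Proof. by rewrite alexandrov_unitsE; exists u. Qed.

(** The map [alexandrov_unit] with values in the subtype on which [iota_ext] is defined. Continuous,
    open and onto, it carries compactness to the unit space. *)
Definition alexandrov_units_of (u : opc) : units :=
  Sub (unit u) (mem_set (gunits_alexandrov_unit u)).

Lemma alexandrov_units_of_surj (x : units) : exists u, alexandrov_units_of u = x.
Proof.
have [u _ ux] : range unit (val x).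
  by rewrite -alexandrov_unitsE; exact: set_mem (valP x).
by exists u; exact: val_inj.
Qed.

Lemma alexandrov_units_of_continuous : continuous alexandrov_units_of.
Proof. by apply: continuous_comp_initial; exact: alexandrov_unit_continuous. Qed.

Lemma alexandrov_units_of_open_map : open_map alexandrov_units_of.
Proof.
move=> U oU; rewrite (_ : _ @` U = val @^-1` (unit @` U)).
  apply: open_comp; first by move=> x _; exact: val_continuous.
  exact: alexandrov_unit_open_map.
apply/seteqP; split=> [_ [u Uu <-]|x [u Uu ux]]; first by exists u.
by exists u => //; exact: val_inj.
Qed.

Lemma alexandrov_units_compact : compact [set: units].
Proof.
rewrite (_ : setT = alexandrov_units_of @` setT).
  apply: continuous_compact; last exact: one_point_compactification_compact.
  by apply: continuous_subspaceT; exact: alexandrov_units_of_continuous.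
apply/seteqP; split=> // x _.
by have [u <-] := alexandrov_units_of_surj x; exists u.
Qed.

End alexandrov.

(** * Extension of a twist *)

Section extension.
Context {R : realType} {G E : topologicalType}.
Context (oG : groupoid_ops G) (oE : groupoid_ops E).
Context (iota : gunits oG * circle R -> E) (pi : E -> G).
Hypotheses (tw : is_twist oG oE iota pi) (rdG : r_discrete oG).

Local Notation units := (gunits (alexandrov_ops oG)).
Local Notation ext := (twist_ext iota).
Local Notation opc := (one_point_compactification (gunits oG)).
Local Notation some := (fun u : gunits oG => alexandrov_units_of (Some u : opc)).
Local Notation none := (alexandrov_units_of (None : opc)).
Local Notation einl := (inl : E -> ext).
Local Notation einr := (inr : circle R -> ext).
Local Notation ieta := (iota_ext iota).

Let lchG : is_lch_groupoid oG. Proof. by case: tw => -[]. Qed.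
Let lchE : is_lch_groupoid oE. Proof. by case: tw => -[]. Qed.
Let gpdG : is_groupoid oG. Proof. by case: lchG => -[]. Qed.
Let gpdE : is_groupoid oE. Proof. by case: lchE => -[]. Qed.

Let hom_iota : groupoid_hom (trivial_bundle_ops (gunits oG)) oE iota.
Proof. by case: tw => _ []. Qed.

Let hom_pi : groupoid_hom oE oG pi. Proof. by case: tw => _ []. Qed.

Let iota_inj : injective iota. Proof. by case: tw => _ _ [[]]. Qed.

Let range_iota : range iota = pi @^-1` gunits oG.
Proof. by case: tw => _ _ [[]]. Qed.

Let iota_continuous : continuous iota. Proof. by case: tw => _ _ [[]]. Qed.

Let pi_continuous : continuous pi. Proof. by case: tw => _ _ _ []. Qed.

(** The range of [iota] is the preimage under [pi] of the units, which is open by r-discreteness; so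
    relatively open images are open in [E]. *)
Let iota_open_map : open_map iota.
Proof.
case: tw => _ _ [[_ _ _ oI] _] _ _ V /oI[W oW ->]; apply: openI => //.
by apply: open_comp => // e _; exact: pi_continuous.
Qed.

(** Let [v] be the image under [pi] of the unit [iota (u, 1)]. The axiom on units gives
    [iota (v, 1) = iota (u, 1)], so [v = u] by injectivity. For other [z], the pairs [(u, 1)] and
    [(u, z)] are composable, hence so are their images in [G], two units that must therefore
    agree. *)
Lemma twist_pi_iota u z : pi (iota (u, z)) = val u.
Proof.
have piU v w : gunits oG (pi (iota (v, w))).
  by rewrite -[gunits oG _]/((pi @^-1` gunits oG) _) -range_iota; exists (v, w).
have uE : gunits oE (iota (u, circle1)).
  apply: (hom_units (trivial_bundle_groupoid R (gunits oG)) gpdE hom_iota).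
  exists (u, circle1) => //; rewrite /grange /=; congr (_, _).
  by rewrite circleMV.
have pi1 : pi (iota (u, circle1)) = val u.
  have [_ _ [_ iota1] _ _] := tw.
  pose v : gunits oG := Sub (pi (iota (u, circle1))) (mem_set (piU u circle1)).
  have /iota_inj[vu] := iota1 _ v uE erefl; exact: (congr1 val vu).
have [c _] := hom_iota
  (erefl : gcomp (trivial_bundle_ops (gunits oG)) ((u, circle1), (u, z))).
by have [/(gcomp_units gpdG) <- //] := hom_pi c.
Qed.

(** * The charts [inl] and [iota_ext] and the basis of the topology *)

Lemma units_case (x : units) : x = none \/ exists u, x = some u.
Proof.
by have [[u|] <-] := alexandrov_units_of_surj x; [right; exists u|left].
Qed.

Lemma iota_ext_someE u z : ieta (some u, z) = einl (iota (u, z)).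
Proof. exact: iota_ext_some. Qed.

Lemma iota_ext_noneE z : ieta (none, z) = einr z.
Proof. exact: iota_ext_infty. Qed.

Lemma iota_ext_inj : injective ieta.
Proof.
move=> [x z] [y w]; have [->|[u ->]] := units_case x;
  have [->|[v ->]] := units_case y; rewrite ?iota_ext_someE ?iota_ext_noneE //.
- by move=> [->].
- by move=> [/iota_inj [-> ->]].
Qed.

Lemma some_continuous : continuous some.
Proof.
move=> u; apply: (@continuous_comp _ opc _ Some (@alexandrov_units_of _ oG)).
  exact: one_point_compactification_some_continuous.
exact: alexandrov_units_of_continuous.
Qed.

Lemma some_open_map : open_map some.
Proof.
move=> U oU; rewrite -(image_comp (Some : _ -> opc) (@alexandrov_units_of _ oG)).
apply: alexandrov_units_of_open_map => //.
exact: one_point_compactification_open_some.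
Qed.

(** The part of [V] over finite units; its image under [iota] is what the image of [V] under
    [iota_ext] leaves in [E]. *)
Let trace (V : set (units * circle R)) : set (gunits oG * circle R) :=
  [set p | V (some p.1, p.2)].

Let open_trace V : open V -> open (trace V).
Proof.
move=> oV.
apply: (@open_comp _ _ (fun p : gunits oG * circle R => (some p.1, p.2))) => //.
move=> [u z] _; apply: (@cvg_pair _ _ _ _ (nbhs (some u)) (nbhs z)).
  apply: (@cvg_comp _ _ _ (fst : gunits oG * circle R -> _) some _ (nbhs u)).
    exact: cvg_fst.
  exact: some_continuous.
exact: cvg_snd.
Qed.

Lemma inl_preimage_iota_ext V : einl @^-1` (ieta @` V) = iota @` trace V.
Proof.
apply/seteqP; split=> [e [[x z]]|_ [[u z] Vuz <-]]; last first.
  by exists (some u, z) => //; exact: iota_ext_someE.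
have [->|[u ->]] := units_case x; rewrite ?iota_ext_someE ?iota_ext_noneE //.
by move=> Vuz [<-]; exists (u, z).
Qed.

Lemma inl_preimage_image U : einl @^-1` (einl @` U) = U.
Proof. by apply/seteqP; split=> [e [f Uf [<-]]|e Ue] //; exists e. Qed.

Lemma twist_ext_basisI : setI_closed (twist_ext_basis iota).
Proof.
have mixed U V : open U -> open V ->
    twist_ext_basis iota (einl @` U `&` ieta @` V).
  (* A mixed intersection is a subset of [E], open there because [iota] is an open map. *)
  move=> oU oV; left; right; exists (U `&` einl @^-1` (ieta @` V)).
    apply: openI => //; rewrite inl_preimage_iota_ext.
    exact/iota_open_map/open_trace.
  apply/seteqP; split=> [_ [e [Ue Ve] <-]|_ [[e Ue <-] Ve]]; last by exists e.
  by split=> //; exists e.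
move=> A B [[->|[U oU <-]]|[U oU <-]]; first by rewrite setTI.
- case=> [[->|[V oV <-]]|[V oV <-]]; [| |exact: mixed].
  + by rewrite setIT; left; right; exists U.
  + left; right; exists (U `&` V); first exact: openI.
    by rewrite image_setI_inj // => e f [].
- case=> [[->|[V oV <-]]|[V oV <-]].
  + by rewrite setIT; right; exists U.
  + by rewrite setIC; exact: mixed.
  + right; exists (U `&` V); first exact: openI.
    by rewrite image_setI_inj //; exact: iota_ext_inj.
Qed.

Lemma twist_ext_basisP : basis (twist_ext_basis iota).
Proof. by apply: basis_of_subbase twist_ext_basisI => //; left; left. Qed.

Lemma inl_open_map : open_map einl.
Proof. by move=> U oU; apply: twist_ext_basisP.1; left; right; exists U. Qed.

Lemma iota_ext_open_map : open_map ieta.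
Proof. by move=> U oU; apply: twist_ext_basisP.1; right; exists U. Qed.

Lemma inl_continuous : continuous einl.
Proof.
apply: (basis_continuous twist_ext_basisP) => A [[->|[U oU <-]]|[U oU <-]].
- by rewrite preimage_setT; exact: openT.
- by rewrite inl_preimage_image.
- by rewrite inl_preimage_iota_ext; exact/iota_open_map/open_trace.
Qed.

Lemma iota_ext_continuous : continuous ieta.
Proof.
apply: (basis_continuous twist_ext_basisP) => A [[->|[U oU <-]]|[U oU <-]].
- by rewrite preimage_setT; exact: openT.
(* No point over infinity is in the preimage. Over a finite unit, continuity of [iota] gives a
   product neighbourhood, carried over by the open map [some]. *)
- rewrite openE => -[x z]; have [->|[u ->]] := units_case x;
    rewrite /= ?iota_ext_noneE ?iota_ext_someE => -[e Ue] // [eE].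
  have [[P Q] [/= uP zQ] PQU] : nbhs (u, z) (iota @^-1` U).
    by apply: iota_continuous; apply: open_nbhs_nbhs; rewrite -eE.
  exists (some @` P, Q).
    by split=> //; exact: (open_map_nbhs some_open_map).
  move=> [_ w] [/= [v Pv <-] Qw]; rewrite /= iota_ext_someE.
  by exists (iota (v, w)) => //; exact: (PQU (v, w)).
- rewrite (_ : _ @^-1` _ = U) //.
  apply/seteqP; split=> [p [q Uq /iota_ext_inj <-]|p Up] //.
  by exists p.
Qed.

(** * Separation and local compactness of the extended space *)

Lemma twist_ext_cover (x : ext) : range einl x \/ range ieta x.
Proof.
case: x => [e|z]; first by left; exists e.
by right; exists (none, z); rewrite ?iota_ext_noneE.
Qed.

Lemma twist_ext_hausdorff : hausdorff_space ext.
Proof.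
have [tG _ hG] := lchG; have [_ _ hE] := lchE.
apply: (chart_hausdorff twist_ext_cover) => //.
- exact: inl_open_map.
- exact: iota_ext_open_map.
- by move=> e f [].
- exact: iota_ext_inj.
- apply: hausdorff_prod; last exact: circle_hausdorff.
  exact: alexandrov_units_hausdorff.
(* The overlap is the preimage under [pi] of the units of [G], which are closed. *)
- rewrite inl_preimage_iota_ext (_ : trace setT = setT) // range_iota.
  by apply: preimage_closed (closed_gunits tG hG) => e _; exact: pi_continuous.
Qed.

Lemma twist_ext_locally_compact : locally_compact [set: ext].
Proof.
have [_ lE _] := lchE.
apply: (chart_locally_compact twist_ext_cover) => //.
- exact: inl_open_map.
- exact: iota_ext_open_map.
- exact: inl_continuous.
- exact: iota_ext_continuous.
- exact: twist_ext_hausdorff.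
- apply/compact_locally_compact/compact_setX_setT; last exact: circle_compact.
  exact: alexandrov_units_compact.
Qed.

(** * The groupoid structure of the extension *)

Lemma twist_ext_groupoid : is_groupoid (twist_ext_ops oE iota).
Proof.
split.
- by move=> [e|z] /=; rewrite ?(ginvK gpdE) ?circleVK.
- move=> [e|w] [f|z] [g|t] //= cef cfg; last by rewrite circleA.
  by have [c1 c2 ->] := gmulA gpdE cef cfg.
- by move=> [e|z] //=; exact: gcompVx.
- by move=> [e|w] [f|z] //= cef; rewrite ?gmulKV ?circleVM.
- by move=> [e|w] [f|z] //= cef; rewrite ?gmulVK ?circleMK.
Qed.

Lemma iota_ext_hom :
  groupoid_hom (trivial_bundle_ops units) (twist_ext_ops oE iota) ieta.
Proof.
move=> [x w] [_ z] /= <-; have [->|[u ->]] := units_case x.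
  by rewrite !iota_ext_noneE.
have [c e] := hom_iota
  (erefl : gcomp (trivial_bundle_ops (gunits oG)) ((u, w), (u, z))).
by rewrite !iota_ext_someE; split=> //=; rewrite -e.
Qed.

Lemma pi_ext_hom : groupoid_hom (twist_ext_ops oE iota) (alexandrov_ops oG)
  (pi_ext iota pi).
Proof.
move=> [e|w] [f|z] //= cef.
by have [c ->] := hom_pi cef.
Qed.

(** Reading [pi_ext] as the first projection serves to reflect composability along [iota_ext] and to
    treat continuity and openness of [pi_ext] near infinity. *)
Lemma pi_ext_iota_ext p : pi_ext iota pi (ieta p) = val p.1.
Proof.
case: p => x z; have [->|[u ->]] := units_case x.
  by rewrite iota_ext_noneE.
by rewrite iota_ext_someE /= twist_pi_iota.
Qed.

Lemma twist_ext_lch : is_lch_groupoid (twist_ext_ops oE iota).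
Proof.
split; [|exact: twist_ext_locally_compact|exact: twist_ext_hausdorff].
have [[_ cmul cinv] _ _] := lchE.
have gA := alexandrov_groupoid lchG.
have [//||||||] := @chart_groupoid_continuous _ _ _ oE (trivial_bundle_ops units)
  (twist_ext_ops oE iota) einl ieta.
- by split=> //; [exact: inl_continuous|exact: inl_open_map].
- split.
  + exact: iota_ext_continuous.
  + exact: iota_ext_open_map.
  (* Applying [pi_ext] to a composable pair yields the composable units [x] and [y], which are then
     equal. *)
  + move=> [x w] [y z] /pi_ext_hom []; rewrite !pi_ext_iota_ext /= => c _.
    apply/val_inj/(gcomp_units gA) => //; first exact: set_mem (valP x).
    exact: set_mem (valP y).
  + exact: iota_ext_hom.
  + move=> p; apply: (hom_inv _ twist_ext_groupoid iota_ext_hom).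
    exact: trivial_bundle_groupoid.
- by split.
- exact: trivial_bundle_continuous.
- exact: twist_ext_cover.
- move=> [e|w] [f|z] //= _; first by left; split; [exists e|exists f].
  by right; split; [exists (none, w)|exists (none, z)]; rewrite ?iota_ext_noneE.
- by move=> c1 c2; split=> //; exact: twist_ext_groupoid.
Qed.

(** * The twist axioms for the extension *)

Lemma range_iota_ext : range ieta = pi_ext iota pi @^-1` units.
Proof.
apply/seteqP; split=> [_ [p _ <-]|[e|z]].
- by rewrite /= pi_ext_iota_ext; exact: set_mem (valP p.1).
- move=> /= pe.
  have [[u|] // _ [ue]] : range (@alexandrov_unit _ oG) (Some (pi e)).
    by rewrite -alexandrov_unitsE.
  have [[v z] _ ve] : range iota e.
    by rewrite range_iota /= -ue; exact: set_mem (valP u).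
  by exists (some v, z) => //; rewrite iota_ext_someE ve.
- by exists (none, z) => //; exact: iota_ext_noneE.
Qed.

Lemma pi_ext_continuous : continuous (pi_ext iota pi).
Proof.
apply: (basis_continuous (alexandrov_basisP rdG)).
move=> A [[->|[U oU <-]]|[U oU <-]].
- by rewrite preimage_setT; exact: openT.
(* Over units every point lies in the range of [iota_ext], where [pi_ext] is the first projection;
   the preimage is thus the image of an open cylinder. *)
- rewrite (_ : _ @^-1` _ = ieta @` (fst @^-1` (@alexandrov_units_of _ oG @` U))).
    apply/iota_ext_open_map/open_comp; first by move=> p _; exact: cvg_fst.
    exact: alexandrov_units_of_open_map.
  apply/seteqP; split=> [x [u Uu ux]|_ [p [u Uu up] <-]]; last first.
    by exists u; rewrite // pi_ext_iota_ext -up.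
  have [p _ px] : range ieta x.
    rewrite range_iota_ext /= -ux; exact: gunits_alexandrov_unit.
  exists p => //; exists u => //; apply: val_inj.
  by rewrite -pi_ext_iota_ext px.
- rewrite (_ : _ @^-1` _ = einl @` (pi @^-1` U)).
    by apply/inl_open_map/open_comp => // e _; exact: pi_continuous.
  by apply/seteqP; split=> [[e|z] [g Ug] // [ge]|_ [e Ue <-]];
    [exists e; rewrite //= -ge|exists (pi e)].
Qed.

Lemma range_pi_ext : range (pi_ext iota pi) = setT.
Proof.
have [_ _ _ [_ _ range_pi] _] := tw.
apply/seteqP; split=> // -[g|] _; last by exists (einr circle1).
have [e _ <-] : range pi g by rewrite range_pi.
by exists (einl e).
Qed.

Lemma pi_ext_open_map : open_map (pi_ext iota pi).
Proof.
have [_ _ _ [_ open_pi _] _] := tw.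
apply: (basis_open_map twist_ext_basisP) => A [[->|[U oU <-]]|[U oU <-]].
- by rewrite range_pi_ext; exact: openT.
- rewrite (_ : _ @` _ = Some @` (pi @` U)).
    by apply: Some_open_map => //; exact: open_pi.
  by rewrite !image_comp.
(* In this chart [pi_ext] is the open first projection followed by the inclusion of the open unit
   space. *)
- rewrite (_ : _ @` _ = val @` (fst @` U)).
    by apply: val_open_map; [exact: open_alexandrov_units|exact: fst_open].
  rewrite !image_comp; apply: eq_imagel => p _ /=; exact: pi_ext_iota_ext.
Qed.

Lemma twist_ext_twist : is_twist (alexandrov_ops oG) (twist_ext_ops oE iota)
  ieta (pi_ext iota pi).
Proof.
have [_ _ [_ iota1] _ central] := tw.
have someE (x : units) g : val x = Some g ->
    exists2 u : gunits oG, x = some u & val u = g.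
  by have [->|[u ->]] := units_case x => //= -[<-]; exists u.
have noneE (x : units) : val x = None -> x = none.
  by have [->|[u ->]] := units_case x.
split.
- by split; [exact: alexandrov_lch|exact: twist_ext_lch].
- by split; [exact: iota_ext_hom|exact: pi_ext_hom].
- split.
    split; [exact: iota_ext_inj|exact: range_iota_ext|exact: iota_ext_continuous|].
    move=> V /iota_ext_open_map oV; exists (ieta @` V) => //.
    by rewrite -range_iota_ext setIC; apply/esym/setIidl/image_subset.
  (* A unit is the range of some [f] in [E] or of some [w] at infinity; in the second case it is
     [w w^-1 = 1]. *)
  move=> [e|z] x [[f|w] _ //= fe] /=.
  + move=> /someE[u -> upi]; rewrite iota_ext_someE (iota1 e) //.
    by case: fe => <-; exact: gunits_range.
  + by move=> /noneE ->; rewrite iota_ext_noneE; case: fe => <-; rewrite circleMV.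
- split; [exact: pi_ext_continuous|exact: pi_ext_open_map|exact: range_pi_ext].
(* In [E] this is the centrality of [iota]; at infinity it is commutativity of the circle. *)
- move=> [e|w] z x y /=.
  + move=> /someE[u -> ur] /someE[v -> vs].
    by rewrite !iota_ext_someE (central e z u v).
  + by move=> /noneE -> /noneE ->; rewrite !iota_ext_noneE circleC.
Qed.

End extension.

Theorem lemma3p6 (R : realType) (G E : topologicalType)
    (oG : groupoid_ops G) (oE : groupoid_ops E)
    (iota : gunits oG * circle R -> E) (pi : E -> G) :
  is_twist oG oE iota pi ->
  is_lch_groupoid oG ->
  r_discrete oG ->
  ~ compact (gunits oG) ->
  [/\ (* (1) *)
      [/\ basis (twist_ext_basis iota),
          open_map (iota_ext iota) &
          continuous (iota_ext iota)],
      (* (2) *)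
      [/\ forall U : set E,
            open U <->
            exists2 W : set (twist_ext iota),
              open W & (inl : E -> twist_ext iota) @^-1` W = U,
          is_lch_groupoid (twist_ext_ops oE iota) &
          forall x : twist_ext iota,
            pi_ext iota pi (grange (twist_ext_ops oE iota) x)
              = range_ext oE iota pi x /\
            pi_ext iota pi (gsource (twist_ext_ops oE iota) x)
              = source_ext oE iota pi x]
    & (* (3) *)
      is_twist (alexandrov_ops oG) (twist_ext_ops oE iota)
        (iota_ext iota) (pi_ext iota pi)].
Proof.
move=> tw _ rdG _; split; last exact: twist_ext_twist.
- split; [exact: twist_ext_basisP tw rdG|exact: iota_ext_open_map tw rdG|].
  exact: iota_ext_continuous tw rdG.
- split; [|exact: twist_ext_lch tw rdG|by case].
  move=> U; split=> [oU|[W oW <-]].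
    (* The image of [U] is open in the extension and, [inl] being injective, its trace on [E] is
       [U]. *)
    exists ((inl : E -> twist_ext iota) @` U); first exact: (inl_open_map tw rdG).
    exact: inl_preimage_image.
  by apply: open_comp oW => e _; exact: (inl_continuous tw rdG).
Qed.
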